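(* Let $x_1,x_2,x_3\ge 0$ be real numbers with $(x_1,x_2,x_3)\neq(0,0,0)$. Then $$\begin{aligned} (1)\quad (x_1+x_2+x_3)^3 &> 12x_1x_2x_3+6x_1^2x_2+6x_2^2x_3;\\ (2)\quad (x_1+x_2+x_3)^3 &> 12x_1x_2x_3+6x_1^2x_3+6x_2^2x_3;\\ (3)\quad (x_1+x_2+x_3)^3 &> 12x_1x_2x_3+6x_1^2x_3+3x_1^2x_2;\\ (4)\quad (x_1+x_2+x_3)^3 &> 6x_1x_2x_3+3x_1^2x_2+6x_1^2x_3+6x_2^2x_3;\\ (5)\quad (x_1+x_2+x_3)^3 &> 6x_1^2x_2+6x_1^2x_3+6x_2^2x_3. \end{aligned}$$ Furthermore, for all such $(x_1,x_2,x_3)$, these strict inequalities still hold if the monomials $x_2^2x_3$ and $x_2x_3^2$ are interchanged (i.e. $x_2^2x_3$ is replaced by $x_2x_3^2$ wherever it appears on the right-hand side), or if the variables $x_1,x_2,x_3$ are permuted by an arbitrary permutation. *)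

(* Defs.v *)
From mathcomp Require Import all_boot all_order all_algebra all_fingroup.
From mathcomp Require Import reals.

Set Implicit Arguments.
Unset Strict Implicit.
Unset Printing Implicit Defensive.

Import Order.TTheory GRing.Theory Num.Theory.
Local Open Scope ring_scope.

(* The argument m stands for the monomial in (x2, x3) that is either
   x2^2 x3 or, after the interchange, x2 x3^2. *)
Definition cubic_ineqs (R : realType) (m : R -> R -> R) (x1 x2 x3 : R) : Prop :=
  [/\ (x1 + x2 + x3) ^+ 3 >
        12 * x1 * x2 * x3 + 6 * x1 ^+ 2 * x2 + 6 * m x2 x3,
      (x1 + x2 + x3) ^+ 3 >
        12 * x1 * x2 * x3 + 6 * x1 ^+ 2 * x3 + 6 * m x2 x3,
      (x1 + x2 + x3) ^+ 3 >
        12 * x1 * x2 * x3 + 6 * x1 ^+ 2 * x3 + 3 * x1 ^+ 2 * x2,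
      (x1 + x2 + x3) ^+ 3 >
        6 * x1 * x2 * x3 + 3 * x1 ^+ 2 * x2 + 6 * x1 ^+ 2 * x3 + 6 * m x2 x3
    & (x1 + x2 + x3) ^+ 3 >
        6 * x1 ^+ 2 * x2 + 6 * x1 ^+ 2 * x3 + 6 * m x2 x3].

Definition sq_left (R : realType) (a b : R) : R := a ^+ 2 * b.
Definition sq_right (R : realType) (a b : R) : R := a * b ^+ 2.

(* The coordinates x_1, x_2, x_3 of a row vector are indexed by 0, 1, 2. *)
Definition cubic_ineqs_at (R : realType) (m : R -> R -> R) (x : 'rV[R]_3) :
    Prop :=
  cubic_ineqs m (x 0 (inord 0)) (x 0 (inord 1)) (x 0 (inord 2)).

(* Main.v *)
(** Each difference of the two sides is a positive multiple of the cube
    [(a + b + c) ^+ 3] plus a combination, with nonnegative coefficients, of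
    cubic monomials and of products [t * l ^+ 2], where [t] is one of the
    variables and [l] a linear form; [lra] finds the coefficients. Exchanging
    [x2] and [x3] turns the [x2 * x3 ^+ 2] versions of (1), (2) and (5) into the
    [x2 ^+ 2 * x3] versions of (2), (1) and (5); only the two versions of (4)
    are not related in this way. *)
Require Import Defs.
From mathcomp Require Import all_boot all_order all_algebra all_fingroup.
From mathcomp Require Import reals.
From mathcomp Require Import lra.

Import Order.TTheory GRing.Theory Num.Theory.
Local Open Scope ring_scope.

(** These are all ten cubic monomials in three variables. [lra] treats them as independent atoms, so
    their signs have to be supplied. *)
Lemma cubic_monomials_ge0 (R : realFieldType) (a b c : R) :
    0 <= a -> 0 <= b -> 0 <= c ->
  [/\ 0 <= a ^+ 3, 0 <= b ^+ 3, 0 <= c ^+ 3, 0 <= a * b * c &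
    [/\ 0 <= a ^+ 2 * b, 0 <= a ^+ 2 * c, 0 <= b ^+ 2 * c &
      [/\ 0 <= a * b ^+ 2, 0 <= a * c ^+ 2 & 0 <= b * c ^+ 2]]].
Proof. by move=> a_ge0 b_ge0 c_ge0; do !split; rewrite ?mulr_ge0 ?exprn_ge0. Qed.

(** The ratio of the left side to the cube is largest in the direction (2, 2, 1), where it is 120 /
    125. *)
Lemma cube_sum_gt_abc_aab_bbc (R : realFieldType) (a b c : R) :
    0 <= a -> 0 <= b -> 0 <= c -> 0 < a + b + c ->
  12 * a * b * c + 6 * a ^+ 2 * b + 6 * (b ^+ 2 * c)
    < (a + b + c) ^+ 3.
Proof.
(* [sum3_gt0] is the only strict fact available to [lra], hence the source of strictness. *)
move=> a_ge0 b_ge0 c_ge0 /(exprn_gt0 3) sum3_gt0.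
case: (cubic_monomials_ge0 _ _ _ _ a_ge0 b_ge0 c_ge0) => ? ? ? ? [? ? ? [? ? ?]].
have := mulr_ge0 b_ge0 (sqr_ge0 (a + 2 * b - 4 * c)).
have := mulr_ge0 b_ge0 (sqr_ge0 (a - 3 * b + 3 * c)).
have := mulr_ge0 a_ge0 (sqr_ge0 (a - 2 * b + 3 * c)).
have := mulr_ge0 a_ge0 (sqr_ge0 (2 * a - 3 * b + 2 * c)).
lra.
Qed.

(** The left side is [6 * c * (a + b) ^+ 2], which is at most 8/9 of the cube by AM-GM. *)
Lemma cube_sum_gt_abc_aac_bbc (R : realFieldType) (a b c : R) :
    0 <= a -> 0 <= b -> 0 <= c -> 0 < a + b + c ->
  12 * a * b * c + 6 * a ^+ 2 * c + 6 * (b ^+ 2 * c)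
    < (a + b + c) ^+ 3.
Proof.
move=> a_ge0 b_ge0 c_ge0 /(exprn_gt0 3) sum3_gt0.
case: (cubic_monomials_ge0 _ _ _ _ a_ge0 b_ge0 c_ge0) => ? ? ? ? [? ? ? [? ? ?]].
have := mulr_ge0 b_ge0 (sqr_ge0 (3 * b - 4 * c)).
have := mulr_ge0 a_ge0 (sqr_ge0 (a + 3 * b - 4 * c)).
have := mulr_ge0 b_ge0 (sqr_ge0 (3 * a + b - 4 * c)).
have := mulr_ge0 a_ge0 (sqr_ge0 (2 * a + 2 * b - 3 * c)).
lra.
Qed.

Lemma cube_sum_gt_abc_aac_aab (R : realFieldType) (a b c : R) :
    0 <= a -> 0 <= b -> 0 <= c -> 0 < a + b + c ->
  12 * a * b * c + 6 * a ^+ 2 * c + 3 * a ^+ 2 * b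
    < (a + b + c) ^+ 3.
Proof.
move=> a_ge0 b_ge0 c_ge0 /(exprn_gt0 3) sum3_gt0.
case: (cubic_monomials_ge0 _ _ _ _ a_ge0 b_ge0 c_ge0) => ? ? ? ? [? ? ? [? ? ?]].
(* The tightest direction is (4, 1, 2), where the sides are 336 and 343. The four linear forms take
   the values 1, -1, 0, -1 there, so they are small where the margin is smallest. *)
have := mulr_ge0 a_ge0 (sqr_ge0 (2 * a + b - 4 * c)).
have := mulr_ge0 a_ge0 (sqr_ge0 (3 * b - 2 * c)).
have := mulr_ge0 c_ge0 (sqr_ge0 (a - 2 * b - c)).
have := mulr_ge0 a_ge0 (sqr_ge0 (2 * a - 3 * b - 3 * c)).
lra.
Qed.

Lemma cube_sum_gt_abc_aab_aac_bbc (R : realFieldType) (a b c : R) :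
    0 <= a -> 0 <= b -> 0 <= c -> 0 < a + b + c ->
  6 * a * b * c + 3 * a ^+ 2 * b + 6 * a ^+ 2 * c + 6 * (b ^+ 2 * c)
    < (a + b + c) ^+ 3.
Proof.
move=> a_ge0 b_ge0 c_ge0 /(exprn_gt0 3) sum3_gt0.
case: (cubic_monomials_ge0 _ _ _ _ a_ge0 b_ge0 c_ge0) => ? ? ? ? [? ? ? [? ? ?]].
have := mulr_ge0 c_ge0 (sqr_ge0 (a + 2 * b - 4 * c)).
have := mulr_ge0 b_ge0 (sqr_ge0 (a + 2 * b - 4 * c)).
have := mulr_ge0 a_ge0 (sqr_ge0 (2 * a - b - 4 * c)).
lra.
Qed.

Lemma cube_sum_gt_abc_aab_aac_bcc (R : realFieldType) (a b c : R) :
    0 <= a -> 0 <= b -> 0 <= c -> 0 < a + b + c ->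
  6 * a * b * c + 3 * a ^+ 2 * b + 6 * a ^+ 2 * c + 6 * (b * c ^+ 2)
    < (a + b + c) ^+ 3.
Proof.
move=> a_ge0 b_ge0 c_ge0 /(exprn_gt0 3) sum3_gt0.
case: (cubic_monomials_ge0 _ _ _ _ a_ge0 b_ge0 c_ge0) => ? ? ? ? [? ? ? [? ? ?]].
have := mulr_ge0 c_ge0 (sqr_ge0 (a + 4 * b - 2 * c)).
have := mulr_ge0 c_ge0 (sqr_ge0 (a - 4 * b + 3 * c)).
have := mulr_ge0 a_ge0 (sqr_ge0 (a + 2 * b - 4 * c)).
have := mulr_ge0 a_ge0 (sqr_ge0 (3 * a - b - 4 * c)).
lra.
Qed.

Lemma cube_sum_gt_aab_aac_bbc (R : realFieldType) (a b c : R) :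
    0 <= a -> 0 <= b -> 0 <= c -> 0 < a + b + c ->
  6 * a ^+ 2 * b + 6 * a ^+ 2 * c + 6 * (b ^+ 2 * c)
    < (a + b + c) ^+ 3.
Proof.
move=> a_ge0 b_ge0 c_ge0 /(exprn_gt0 3) sum3_gt0.
case: (cubic_monomials_ge0 _ _ _ _ a_ge0 b_ge0 c_ge0) => ? ? ? ? [? ? ? [? ? ?]].
have := mulr_ge0 b_ge0 (sqr_ge0 (a - 3 * b + 4 * c)).
have := mulr_ge0 b_ge0 (sqr_ge0 (a + b - 4 * c)).
have := mulr_ge0 a_ge0 (sqr_ge0 (a - 3 * b - 3 * c)).
have := mulr_ge0 a_ge0 (sqr_ge0 (2 * a - 3 * b - 3 * c)).
lra.
Qed.

(** Both hypotheses are stable under permuting coordinates, so this serves for [x] and for each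
    [col_perm s x]. *)
Lemma cubic_ineqs_at_sq (R : realType) (x : 'rV[R]_3) :
    (forall i, 0 <= x 0 i) -> x != 0 ->
  cubic_ineqs_at (@sq_left R) x /\ cubic_ineqs_at (@sq_right R) x.
Proof.
move=> x_ge0 x_neq0; rewrite /cubic_ineqs_at.
have : 0 < x 0 (inord 0) + x 0 (inord 1) + x 0 (inord 2).
  have -> : x 0 (inord 0) + x 0 (inord 1) + x 0 (inord 2) = \sum_i x 0 i.
    rewrite !big_ord_recl big_ord0 addr0 addrA.
    (* [big_ord_recl] produces iterated lifts of [ord0]; they agree with the [inord] indices by
       value. *)
    by congr (_ + _ + _); congr (x _ _); apply: val_inj; rewrite /= inordK.
  rewrite lt0r sumr_ge0 // andbT; apply: contraNneq x_neq0 => sum0.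
  apply/eqP/rowP => i; rewrite mxE.
  exact: (psumr_eq0P (fun i _ => x_ge0 i) sum0).
move: (x_ge0 (inord 0)) (x_ge0 (inord 1)) (x_ge0 (inord 2)).
move: (x 0 (inord 0)) (x 0 (inord 1)) (x 0 (inord 2)) => a b c a_ge0 b_ge0 c_ge0 abc_gt0.
have acb_gt0 : 0 < a + c + b by rewrite addrAC.
split; split; rewrite /sq_left /sq_right.
- exact: cube_sum_gt_abc_aab_bbc.
- exact: cube_sum_gt_abc_aac_bbc.
- exact: cube_sum_gt_abc_aac_aab.
- exact: cube_sum_gt_abc_aab_aac_bbc.
- exact: cube_sum_gt_aab_aac_bbc.
- by have := cube_sum_gt_abc_aac_bbc _ _ _ _ a_ge0 c_ge0 b_ge0 acb_gt0; lra.
- by have := cube_sum_gt_abc_aab_bbc _ _ _ _ a_ge0 c_ge0 b_ge0 acb_gt0; lra.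
(* The third inequality does not involve [m], so no exchange occurs. *)
- exact: cube_sum_gt_abc_aac_aab.
- exact: cube_sum_gt_abc_aab_aac_bcc.
- by have := cube_sum_gt_aab_aac_bbc _ _ _ _ a_ge0 c_ge0 b_ge0 acb_gt0; lra.
Qed.

Theorem corollary3p5 (R : realType) (x : 'rV[R]_3)
    (x_ge0 : forall i, 0 <= x 0 i) (x_neq0 : x != 0) :
  cubic_ineqs_at (@sq_left R) x
  /\ cubic_ineqs_at (@sq_right R) x
  /\ (forall s : 'S_3, cubic_ineqs_at (@sq_left R) (col_perm s x)
                    /\ cubic_ineqs_at (@sq_right R) (col_perm s x)).
Proof.
have [left_x right_x] := cubic_ineqs_at_sq _ _ x_ge0 x_neq0.
split=> //; split=> // s; apply: cubic_ineqs_at_sq => [i|].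
  by rewrite mxE.
apply: contraNneq x_neq0 => sx0; apply/eqP/rowP => i.
(* Entry [j] of [col_perm s x] is entry [s j] of [x], so entry [i] of [x] is reached from
   [s^-1 i]. *)
by move/rowP/(_ ((s^-1)%g i)): sx0; rewrite !mxE permKV.
Qed.
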